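(* For all $\varepsilon>0$, $n_0\in\mathbb{N}$ and $C>0$ there exists $d_0=d_0(\varepsilon,n_0,C)$ such that for every $d>d_0$ there exists a harmonic function $u:\mathbb{Z}^d\to\mathbb{R}$ such that $$Q_u(2n)>C\sqrt{Q_u(n)Q_u(4n)}+2^{-n^{0.5+\varepsilon}}Q_u(4n)$$ for some integer $n>n_0$.
   Context: A function $u:\mathbb{Z}^d\to\mathbb{R}$ is harmonic if $\Delta u\equiv0$, where $(\Delta u)(x)=\frac{1}{2d}\sum_{y\sim x}(u(y)-u(x))$ and $y\sim x$ means nearest neighbours in $\mathbb{Z}^d$. $(X_n)_{n\ge0}$ is the simple random walk on $\mathbb{Z}^d$ starting at $0$, and $Q_u(n):=\mathbb{E}(u(X_n)^2)$. *)

(* Defs.v *)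
From HB Require Import structures.
From mathcomp Require Import all_boot all_order all_algebra finmap.
From mathcomp Require Import all_classical all_reals all_analysis.

Set Implicit Arguments.
Unset Strict Implicit.
Unset Printing Implicit Defensive.

Import Order.TTheory GRing.Theory Num.Theory.

Local Open Scope classical_set_scope.
Local Open Scope ring_scope.

(* The nearest neighbours of x in Z^d = 'rV[int]_d are the 2d distinct points *)
(* x + unit_step p: the index (i, b) stands for the vector (-1)^b e_i.        *)
Definition unit_step (d : nat) (p : 'I_d * bool) : 'rV[int]_d :=
  (-1) ^+ p.2 *: delta_mx 0 p.1.

Definition laplacian (R : realType) (d : nat) (u : 'rV[int]_d -> R)
    (x : 'rV[int]_d) : R :=
  ((2 * d)%N%:R)^-1 * \sum_(p : 'I_d * bool) (u (x + unit_step p) - u x).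

Definition is_harmonic (R : realType) (d : nat) (u : 'rV[int]_d -> R) : Prop :=
  forall x, laplacian u x = 0.

(* Mutual independence of a sequence of random elements of a set E carrying   *)
(* the discrete sigma-algebra.                                                *)
Definition mutually_independent (R : realType) (disp : measure_display)
    (T : measurableType disp) (P : probability T R) (E : Type)
    (xi : nat -> T -> E) : Prop :=
  forall (J : {fset nat}) (A : nat -> set E),
    P (\bigcap_(k in [set` J]) xi k @^-1` A k) =
    (\prod_(k <- J) P (xi k @^-1` A k))%E.

(* Simple random walk on Z^d started at 0: the increments are independent     *)
(* and uniformly distributed over the 2d unit vectors.                        *)
Definition simple_random_walk (R : realType) (d : nat)
    (disp : measure_display) (T : measurableType disp) (P : probability T R)
    (X : nat -> T -> 'rV[int]_d) : Prop :=
  [/\ forall n (A : set 'rV[int]_d), measurable (X n @^-1` A),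
      forall w, X 0%N w = 0,
      forall n p, P [set w | X n.+1 w - X n w = unit_step p] =
                  ((2 * d)%N%:R^-1)%:E &
      mutually_independent P (fun n w => X n.+1 w - X n w)].

(* Q_u(n) = E(u(X_n)^2).  X_n takes finitely many values almost surely, so    *)
(* the expectation is finite and "fine" loses nothing.                        *)
Definition growth (R : realType) (d : nat) (disp : measure_display)
    (T : measurableType disp) (P : probability T R)
    (X : nat -> T -> 'rV[int]_d) (u : 'rV[int]_d -> R) (n : nat) : R :=
  fine ('E_P[fun w => u (X n w) ^+ 2]).

(* Existence of simple random walk, so that a statement about every such walk *)
(* is not vacuous: on [0, 1] with the uniform law, read off base-2d digits.    *)

Lemma unit_step_inj (d : nat) : injective (@unit_step d).
Proof.
move=> [i b] [j c] /(congr1 (fun M : 'rV[int]_d => M 0 i)).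
rewrite !mxE !eqxx /= mulr1.
case: (eqVneq i j) => [->|_].
  by rewrite mulr1; case: b; case: c.
by rewrite mulr0 => /eqP; rewrite signr_eq0.
Qed.

Lemma measurable_truncn_preimage (R : realType) (a : R) (S : set nat) :
  0 < a -> measurable [set w : measurableTypeR R | S (Num.truncn (a * w))].
Proof.
move=> a0.
have -> : [set w : measurableTypeR R | S (Num.truncn (a * w))] =
    \bigcup_(m in S) [set w : measurableTypeR R | Num.truncn (a * w) = m].
  apply/seteqP; split => w /=; first by exists (Num.truncn (a * w)).
  by case=> m Sm /= ->.
apply: bigcup_measurable => m _.
have mge k : measurable [set w : measurableTypeR R |
    (k < Num.truncn (a * w))%N].
  have -> : [set w : measurableTypeR R | (k < Num.truncn (a * w))%N] =
      `[k.+1%:R / a, +oo[%classic.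
    apply/seteqP; split => w /=;
      by rewrite in_itv /= andbT truncn_gt_nat ler_pdivrMr// mulrC.
  exact: measurable_itv.
have -> : [set w : measurableTypeR R | Num.truncn (a * w) = m] =
    ~` [set w | (m < Num.truncn (a * w))%N] `&`
    (if m is k.+1 then [set w | (k < Num.truncn (a * w))%N] else setT).
  apply/seteqP; split => w /=.
    by move=> tm; rewrite tm ltnn; case: m tm => // k tm; split => //=; rewrite tm.
  case=> /negP; rewrite -leqNgt; case: m => [|k] mle.
    by move=> _; apply/eqP; rewrite -leqn0.
  by move=> kt; apply/eqP; rewrite eqn_leq mle.
apply: measurableI; first exact: measurableC.
by case: m => [|k] //; exact: measurableT.
Qed.

Lemma truncn_divn (R : realType) (x : R) (b : nat) : (0 < b)%N ->
  (Num.truncn (b%:R * x) %/ b)%N = Num.truncn x.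
Proof.
move=> b0; have b0R : 0 < b%:R :> R by rewrite ltr0n.
have [x0|x0] := leP 0 x; last first.
  have /truncn0Pn -> : ~~ (1 <= x) by rewrite -ltNge (lt_trans x0).
  have /truncn0Pn -> : ~~ (1 <= b%:R * x).
    by rewrite -ltNge (lt_trans _ (@ltr01 R))// pmulr_rlt0.
  by rewrite div0n.
apply/esym/truncn_def.
set m := Num.truncn _.
have /andP[m1 m2] : m%:R <= b%:R * x < m.+1%:R.
  by apply: truncn_itv; rewrite mulr_ge0// ltW.
apply/andP; split.
  rewrite -(ler_pM2l b0R) (le_trans _ m1)// -natrM ler_nat mulnC.
  exact: leq_divM.
rewrite -(ltr_pM2l b0R) (lt_le_trans m2)// -natrM ler_nat mulnC.
by rewrite -ltn_divLR.
Qed.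

Lemma truncn_expn_divn (R : realType) (x : R) (b n k : nat) : (0 < b)%N ->
  (Num.truncn ((b ^ (n + k))%N%:R * x) %/ b ^ k)%N =
  Num.truncn ((b ^ n)%N%:R * x).
Proof.
move=> b0; elim: k => [|k IH]; first by rewrite addn0 divn1.
by rewrite addnS !expnS natrM -mulrA -IH divnMA truncn_divn.
Qed.

Lemma uniform_truncn1 (R : realType) (B m : nat) : (m < B)%N ->
  uniform_prob (@ltr01 R) [set w | Num.truncn (B%:R * w) = m] =
  (B%:R^-1)%:E.
Proof.
move=> mB; have B0 : 0 < B%:R :> R by rewrite ltr0n (leq_ltn_trans _ mB).
set I : set R := `[m%:R / B%:R, m.+1%:R / B%:R[%classic.
have subI : I `<=` `[0, 1].
  move=> w; rewrite /I /= !in_itv /= => /andP[w1 w2]; apply/andP; split.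
    by rewrite (le_trans _ w1)// divr_ge0.
  by rewrite (le_trans (ltW w2))// ler_pdivrMr// mul1r ler_nat.
have mI : measurable (I : set (measurableTypeR R)) by exact: measurable_itv.
have memI w : 0 <= w -> I w <-> Num.truncn (B%:R * w) = m.
  move=> w0; rewrite /I /= in_itv /= ler_pdivrMr// ltr_pdivlMr// !(mulrC w).
  have Bw : 0 <= B%:R * w by rewrite mulr_ge0// ltW.
  by rewrite -truncn_eq//; split => /eqP.
rewrite /uniform_prob.
transitivity (\int[lebesgue_measure]_(x in I) (1 : \bar R))%E.
  rewrite integral_mkcond [RHS]integral_mkcond; apply: eq_integral => w _.
  rewrite !patchE /uniform_pdf subr0 invr1.
  have [Iw|Iw] := pselect (I w).
    have w01 := subI _ Iw; rewrite /= in_itv /= in w01; rewrite w01 [in RHS]mem_set//.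
    case/andP: w01 => w0 _; rewrite mem_set//=; exact/memI.
  rewrite [in RHS]memNset//; case: ifPn => //; rewrite inE /= => Hw.
  by case: ifPn => // /andP[w0 _]; case: Iw; apply/memI.
rewrite integral_cst// mul1e [LHS]lebesgue_measure_itv /= lte_fin.
rewrite ltr_pM2r ?invr_gt0// ltr_nat ltnSn -EFinD -mulrBl -natrB//.
by rewrite subSn// subnn mul1r.
Qed.

Lemma uniform_truncn (R : realType) (B : nat) (G : nat -> nat) :
  (0 < B)%N -> (forall m, (G m <= 1)%N) ->
  (uniform_prob (@ltr01 R) : probability (measurableTypeR R) R)
    [set w | G (Num.truncn (B%:R * w)) = 1%N] =
  ((\sum_(0 <= m < B) G m)%N%:R / B%:R)%:E.
Proof.
move=> B0 G1; set P : probability (measurableTypeR R) R := uniform_prob _.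
have B0R : 0 < B%:R :> R by rewrite ltr0n.
pose N (w : measurableTypeR R) := Num.truncn (B%:R * w).
have mN (S : set nat) : measurable (N @^-1` S).
  exact: measurable_truncn_preimage.
have fin (F : nat -> nat) : (forall m, (F m <= 1)%N) ->
    P (N @^-1` [set m | (m < B)%N /\ F m = 1%N]) =
    ((\sum_(0 <= m < B) F m)%N%:R / B%:R)%:E.
  move=> F1.
  have -> : N @^-1` [set m | (m < B)%N /\ F m = 1%N] =
      \big[setU/set0]_(m < B | F m == 1%N) (N @^-1` [set (m : nat)]).
    apply/seteqP; split => w /=.
      case=> NB F1w; rewrite -bigcup_seq_cond.
      by exists (Ordinal NB) => //=; rewrite mem_index_enum F1w.
    rewrite -bigcup_seq_cond => -[m /= /andP[_ /eqP Fm]] ->.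
    by split.
  rewrite measure_bigsetU_ord//; last first.
    by move=> i j _ _ [w [/= -> /val_inj]].
  rewrite (eq_bigr (fun=> (B%:R^-1)%:E)) => [|m _]; last exact: uniform_truncn1.
  rewrite sumEFin; congr (_%:E).
  rewrite big_mkord natr_sum mulr_suml big_mkcond; apply: eq_bigr => m _.
  by case: (F m) (F1 m) => [|[|//]] _ /=; rewrite ?mul0r ?mul1r.
have PltB : P (N @^-1` [set m | (m < B)%N]) = 1%E.
  have := fin (fun=> 1%N) (fun=> leqnn _).
  rewrite sum_nat_const_nat subn0 muln1 divff ?gt_eqF// => <-.
  by congr (P _); apply/seteqP; split => w //= [].
rewrite -(fin G G1).
have -> : [set w | G (Num.truncn (B%:R * w)) = 1%N] =
   N @^-1` [set m | (m < B)%N /\ G m = 1%N] `|`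
   N @^-1` [set m | ~ (m < B)%N /\ G m = 1%N].
  apply/seteqP; split => w /=.
    by move=> Gw; have [lt|ge] := boolP (N w < B)%N; [left|right; split => //; apply/negP].
  by case=> -[].
have P0 : P (N @^-1` [set m | ~ (m < B)%N /\ G m = 1%N]) = 0%E.
  apply/eqP; rewrite eq_le measure_ge0 andbT.
  have <- : P (~` (N @^-1` [set m | (m < B)%N])) = 0%E.
    by rewrite probability_setC// PltB subee.
  apply: le_measure; rewrite ?inE//; first exact: measurableC.
  by move=> w /= [].
rewrite (measureU P (mN _) (mN _)); last by apply/seteqP; split => w //= [[h _] [h' _]].
exact: etrans (congr1 (fun z => _ + z)%E P0) (adde0 _).
Qed.

Lemma sum_prod_digits (b : nat) (g : nat -> nat -> nat) (n : nat) :
  (0 < b)%N ->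
  (\sum_(0 <= m < b ^ n) \prod_(k < n) g k (m %/ b ^ (n - k.+1) %% b) =
   \prod_(k < n) \sum_(0 <= c < b) g k c)%N.
Proof.
move=> b0; elim: n => [|n IH].
  by rewrite big_nat1 !big_ord0.
rewrite expnSr big_nat_mul big_ord_recr /= -IH big_distrl /=.
apply: eq_bigr => i _; rewrite big_distrr /=.
rewrite -[X in (\sum_(X <= _ < _) _)%N](add0n (i * b)%N) big_addn.
rewrite mulSn addnK; apply: eq_big_nat => c /andP[_ cb].
rewrite big_ord_recr /= subnn divn1 (addnC c) modnMDl modn_small//.
congr (_ * _)%N; apply: eq_bigr => k _; congr (g _ (_ %% _)%N).
by rewrite subSS -(subnSK (ltn_ord k)) expnS divnMA divnMDl// (divn_small cb) addn0.
Qed.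

Lemma simple_random_walk_exists (R : realType) (d : nat) : (0 < d)%N ->
  exists (disp : measure_display) (T : measurableType disp)
    (P : probability T R) (X : nat -> T -> 'rV[int]_d),
  simple_random_walk P X.
Proof.
move=> d0; set b := (2 * d)%N.
have b0 : (0 < b)%N by rewrite muln_gt0.
have b0R : 0 < b%:R :> R by rewrite ltr0n.
pose p0 : 'I_d * bool := (Ordinal d0, false).
pose e := enum {: 'I_d * bool}.
have se : size e = b by rewrite -cardE card_prod card_ord card_bool mulnC.
pose st c := unit_step (nth p0 e c).
pose N n (w : measurableTypeR R) := Num.truncn ((b ^ n)%N%:R * w).
pose xi n w := st (N n.+1 w %% b)%N.
pose X n w := \sum_(k < n) xi k w.
have XS n w : X n.+1 w - X n w = xi n w.
  by rewrite /X big_ord_recr /= addrAC subrr add0r.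
pose P : probability (measurableTypeR R) R := uniform_prob (@ltr01 R).
have mN n (S : set nat) : measurable (N n @^-1` S).
  by apply: measurable_truncn_preimage; rewrite ltr0n expn_gt0 b0.
have mX n : forall A, measurable (X n @^-1` A).
  elim: n => [|n IH] A.
    have -> : X 0%N @^-1` A = [set w : measurableTypeR R | A 0].
      by apply/seteqP; split => w; rewrite /= /X big_ord0.
    have [A0|A0] := pselect (A 0).
      have -> : [set w : measurableTypeR R | A 0] = setT.
        by apply/seteqP; split.
      exact: measurableT.
    have -> : [set w : measurableTypeR R | A 0] = set0.
      by apply/seteqP; split.
    exact: measurable0.
  have -> : X n.+1 @^-1` A = \bigcup_(c in setT)
      (X n @^-1` [set x | A (x + st c)] `&`
       N n.+1 @^-1` [set m | (m %% b)%N = c]).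
    apply/seteqP; split => w /=; rewrite /X big_ord_recr /=.
      by move=> Aw; exists (N n.+1 w %% b)%N => //; split.
    by case=> c _ [/= Ax cE]; rewrite /xi cE.
  by apply: bigcup_measurable => c _; apply: measurableI.
pose cnt (B : set 'rV[int]_d) := (\sum_(0 <= c < b) (`[< B (st c) >] : nat))%N.
have law (J : {fset nat}) (A : nat -> set 'rV[int]_d) :
    P (\bigcap_(k in [set` J]) xi k @^-1` A k) =
    (\prod_(k <- J) ((cnt (A k))%:R / b%:R))%:E.
  have [n Jn] : exists n, forall k, k \in J -> (k < n)%N.
    exists (\max_(k <- J) k).+1 => k kJ.
    by rewrite ltnS; exact: (@leq_bigmax_seq _ (enum_fset J) xpredT id k).
  pose g k c : nat := (k \in J) ==> `[< A k (st c) >].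
  pose G m := (\prod_(k < n) g k (m %/ b ^ (n - k.+1) %% b))%N.
  have GE m : G m = [forall k : 'I_n, g k (m %/ b ^ (n - k.+1) %% b)%N == 1%N].
    case: forallP => [H|/forallP]; first by rewrite /G big1// => k _; apply/eqP.
    rewrite negb_forall => /existsP[k gk]; rewrite /G (bigD1 k)//=.
    by move: gk; rewrite {1 2}/g; case: (_ ==> _).
  have -> : \bigcap_(k in [set` J]) xi k @^-1` A k =
      [set w | G (Num.truncn ((b ^ n)%N%:R * w)) = 1%N].
    have NE k w : (k < n)%N ->
        (Num.truncn ((b ^ n)%N%:R * w) %/ b ^ (n - k.+1))%N = N k.+1 w.
      by move=> kn; rewrite -{1}(subnKC kn) truncn_expn_divn.
    apply/seteqP; split => w /=; rewrite GE.
      move=> H; apply/eqP; rewrite eqb1; apply/forallP => k.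
      rewrite NE// /g; case: (boolP (_ \in J)) => //= kJ.
      by rewrite eqb1; apply/asboolP; exact: H.
    move=> /eqP; rewrite eqb1 => /forallP H k /= kJ.
    have := H (Ordinal (Jn k kJ)); rewrite /= NE ?Jn// /g kJ /= eqb1.
    by move=> /asboolP.
  rewrite /P uniform_truncn; [|by rewrite expn_gt0 b0|]; last first.
    by move=> m; rewrite GE leq_b1.
  rewrite sum_prod_digits//; congr (_%:E).
  have bn : (b ^ n)%N%:R = \prod_(k < n) b%:R :> R.
    by rewrite prodr_const card_ord natrX.
  rewrite natr_prod bn -prodf_div.
  rewrite (bigID (fun k : 'I_n => (k : nat) \in J)) /=.
  rewrite [X in _ * X]big1 ?mulr1 => [|k kJ]; last first.
    rewrite (eq_bigr (fun=> 1%N)) => [|c _]; last by rewrite /g (negbTE kJ).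
    by rewrite sum_nat_const_nat subn0 muln1 divff// gt_eqF.
  rewrite -(big_mkord (fun k => k \in J)
    (fun k => (\sum_(0 <= c < b) g k c)%N%:R / b%:R)) -big_filter.
  rewrite (perm_big (enum_fset J)); last first.
    apply: uniq_perm; rewrite ?filter_uniq ?iota_uniq ?fset_uniq// => k.
    rewrite mem_filter mem_index_iota /=.
    by case: (boolP (k \in J)) => //= /Jn ->.
  apply: eq_big_seq => k kJ; congr (_%:R / _).
  by apply: eq_bigr => c _; rewrite /g kJ.
have law1 k B : P (xi k @^-1` B) = ((cnt B)%:R / b%:R)%:E.
  have := law [fset k]%fset (fun=> B).
  rewrite big_seq_fset1 => <-; congr (P _).
  apply/seteqP; split => w /= H; first by move=> j /=; rewrite inE => /eqP ->.
  by apply: (H k); rewrite /= inE.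
exists _, _, (P : probability _ R), X; split => //.
- by move=> w; rewrite /X big_ord0.
- move=> n p.
  have -> : [set w | X n.+1 w - X n w = unit_step p] =
      xi n @^-1` [set unit_step p].
    by apply/seteqP; split => w /=; rewrite XS.
  rewrite [LHS]law1; have -> : cnt [set unit_step p] = 1%N; last by rewrite mul1r.
  rewrite /cnt -se -(big_nth p0 xpredT (fun q => nat_of_bool `[< [set unit_step p] (unit_step q) >])).
  rewrite big_enum (bigD1 p)//= big1 => [|q qp].
    by rewrite addn0; case: asboolP => // -[].
  by case: asboolP => // /unit_step_inj qE; rewrite qE eqxx in qp.
- have xiE : (fun n (w : measurableTypeR R) => X n.+1 w - X n w) = xi.
    by apply/funext => n; apply/funext => w.
  refine (eq_ind_r (@mutually_independent R _ _ P _) _ xiE) => J A.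
  rewrite [LHS]law -prodEFin; apply: eq_bigr => k _; exact/esym/law1.
Qed.

(* Main.v *)
Require Import Defs.
From mathcomp Require Import all_boot all_order all_algebra finmap.
From mathcomp Require Import all_classical all_reals all_analysis.
From mathcomp Require Import measurable_realfun zify ring lra.
Import Order.TTheory GRing.Theory Num.Theory.
Local Open Scope ring_scope.

(* For u = x_1 ... x_k the growth is the single falling factorial             *)
(* Q_u(m) = m^_k / d^k: averaging u^2 over the 2d neighbours adds to it 1/d   *)
(* times the sum of the squares of the k monomials with one factor removed.   *)
(* Take n = N^2 and k = 4MN with M > 2C.  Since k^2 is a large multiple of n, *)
(* the log-concavity of m^_k along n, 2n, 4n gives Q(2n)^2 >= M^2 Q(n) Q(4n), *)
(* while Q(4n) <= 4^k Q(2n) and k = O(sqrt n) is beaten by n^(1/2 + eps).     *)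

(** For multilinear monomials the growth is explicit ([growthE], [iter_walk_mean_coord_prod]), so
    the theorem becomes a question about falling factorials. Since (2n-j)^2 - (n-j)(4n-j) = nj, the
    j-th factors of m^_k at m = n, 2n, 4n have ratio (2n-j)^2 / ((n-j)(4n-j)) at least 1 + j/(4n).
    Hence Q(2n)^2 / (Q(n) Q(4n)) is at least 1 + k(k-1)/(8n), which exceeds any bound once k is a
    large multiple of sqrt n ([ffact_sqrt_gap]). For such k, Q(4n)/Q(2n) is at most 4^k
    ([ffact_quadruple]), which the weight 2^(-n^(1/2+eps)) absorbs ([quadruple_weight]). Each term
    on the right is then at most half of Q(2n), the second strictly less. *)

Lemma ffact_log_concave (n k : nat) : (k <= n)%N ->
  ((8 * n + k * (k - 1)) * (n ^_ k * (4 * n) ^_ k) <= 8 * n * ((2 * n) ^_ k) ^ 2)%N.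
Proof.
elim: k => [_|k IH kn]; first by rewrite !ffactn0 mul0n addn0.
have {IH} := IH (ltnW kn).
rewrite !ffactnSr (_ : k.+1 - 1 = k)%N; last by lia.
move: (n ^_ k) ((4 * n) ^_ k) ((2 * n) ^_ k) => A B F IH.
(* One new factor: the weight grows by 2k, and with y = 2n - k the claim reduces to 2y^2 <= n(8n +
   k(k+1)), clear from y <= 2n. *)
have step : ((8 * n + k.+1 * k) * ((n - k) * (4 * n - k)) <=
    (8 * n + k * (k - 1)) * (2 * n - k) ^ 2)%N.
  case: k kn {IH} => [|k] kn; first by rewrite !subn0; nia.
  have [m ->] : exists m, n = (k.+1 + m)%N by exists (n - k.+1)%N; lia.
  have -> : (k.+1 + m - k.+1 = m)%N by lia.
  have -> : (4 * (k.+1 + m) - k.+1 = 3 * k.+1 + 4 * m)%N by lia.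
  have -> : (2 * (k.+1 + m) - k.+1 = k.+1 + 2 * m)%N by lia.
  rewrite subn1 /=; nia.
move: step; set a := (8 * n + k.+1 * k)%N; set b := (8 * n + k * (k - 1))%N.
set x := ((n - k) * (4 * n - k))%N; set y := (2 * n - k)%N => step.
rewrite mulnACA mulnCA.
apply: (@leq_trans ((A * B) * (b * y ^ 2))%N); first by rewrite leq_mul2l step orbT.
rewrite mulnA (mulnC _ b).
by rewrite expnMn [leqRHS]mulnA leq_mul2r IH orbT.
Qed.

Lemma ffact_quadruple (n k : nat) : (k <= n)%N ->
  ((4 * n) ^_ k <= 4 ^ k * (2 * n) ^_ k)%N.
Proof.
elim: k => [|k IH] kn; first by rewrite !ffactn0.
rewrite !ffactnSr expnS.
have h : (4 * n - k <= 4 * (2 * n - k))%N by lia.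
apply: leq_trans (leq_mul (IH (ltnW kn)) h) _; lia.
Qed.

(** For n = N^2 and k = 4MN the weight 8n + k(k-1) is at least 8n M^2; [4 * M <= N] ensures k <=
    n. *)
Lemma ffact_sqrt_gap (M N : nat) : (0 < M)%N -> (4 * M <= N)%N ->
  (M ^ 2 * ((N ^ 2) ^_ (4 * M * N) * (4 * N ^ 2) ^_ (4 * M * N)) <=
   ((2 * N ^ 2) ^_ (4 * M * N)) ^ 2)%N.
Proof.
move=> M0 MN; set k := (4 * M * N)%N.
have kn : (k <= N ^ 2)%N by rewrite /k expnS expn1 leq_mul2r MN orbT.
have := @ffact_log_concave _ _ kn.
move: (_ ^_ k) (_ ^_ k) (_ ^_ k) => A B F H.
rewrite -(@leq_pmul2l (8 * N ^ 2)); last by nia.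
apply: leq_trans H; rewrite mulnA leq_mul2r; apply/orP; right.
rewrite /k; nia.
Qed.

(** * Growth as an iterated averaging operator *)

Definition walk_mean {R : realType} {d : nat} (f : 'rV[int]_d -> R)
    (x : 'rV[int]_d) : R :=
  ((2 * d)%N%:R)^-1 * \sum_(p : 'I_d * bool) f (x + unit_step p).

Section Walk.
Context {R : realType} {d : nat} {disp : measure_display}
  {T : measurableType disp} {P : probability T R} {X : nat -> T -> 'rV[int]_d}.
Context (walkX : simple_random_walk P X) (p0 : 'I_d * bool).
Local Open Scope classical_set_scope.

(** The cylinder event fixing the first steps. The section variable [p0] is the default of [nth] and
    witnesses that d is positive. *)
Definition walk_prefix (s : seq ('I_d * bool)) : set T :=
  [set w | forall k, (k < size s)%N ->
    X k.+1 w - X k w = unit_step (nth p0 s k)].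

Definition endpoint (s : seq ('I_d * bool)) : 'rV[int]_d := \sum_(p <- s) unit_step p.

Lemma measurable_increment n v : measurable [set w | X n.+1 w - X n w = v].
Proof.
case: walkX => mX _ _ _.
(* The lattice is countable, so conditioning on the value of [X n] gives a countable union. *)
have -> : [set w | X n.+1 w - X n w = v] =
    \bigcup_x (X n @^-1` [set x] `&` X n.+1 @^-1` [set x + v]).
  apply/seteqP; split => w /=.
    by move=> <-; exists (X n w) => //=; split => //=; rewrite addrC subrK.
  by move=> [x _ [/= -> ->]]; rewrite addrAC subrr add0r.
by apply: countable_bigcupT_measurable => // x; exact: measurableI.
Qed.

Lemma walk_prefixE s :
  walk_prefix s = \bigcap_(k in [set` [fset k in iota 0 (size s)]%fset])
    (fun w => X k.+1 w - X k w) @^-1` [set unit_step (nth p0 s k)].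
Proof.
by apply/seteqP; split => w /= H k => [/= |] ks; apply: H;
  move: ks; rewrite /= !inE mem_iota.
Qed.

Lemma measurable_walk_prefix s : measurable (walk_prefix s).
Proof.
rewrite walk_prefixE; apply: fin_bigcap_measurable => [|k _].
  exact: finite_fset.
exact: measurable_increment.
Qed.

Lemma prob_walk_prefix s : P (walk_prefix s) = (((2 * d)%N%:R^-1) ^+ size s)%:E.
Proof.
case: walkX => _ _ uX indX.
rewrite walk_prefixE; have -> := indX _ (fun k => [set unit_step (nth p0 s k)]).
rewrite (eq_bigr (fun=> ((2 * d)%N%:R^-1)%:E)); last by move=> k _; exact: uX.
rewrite prodEFin; congr (_%:E).
rewrite (perm_big (index_iota 0 (size s))) /=; last first.
  apply: uniq_perm; rewrite ?fset_uniq ?iota_uniq// => k.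
  by rewrite mem_index_iota !inE mem_iota.
by rewrite big_mkord prodr_const card_ord.
Qed.

Lemma walk_prefix_endpoint s w : walk_prefix s w -> X (size s) w = endpoint s.
Proof.
case: walkX => _ X0 _ _; rewrite /endpoint.
elim/last_ind: s => [|s p IH] H; first by rewrite X0 big_nil.
have Hs : walk_prefix s w.
  move=> k ks; rewrite H; first by rewrite nth_rcons ks.
  by rewrite size_rcons ltnS ltnW.
rewrite -cats1 big_cat /= big_seq1 cats1 size_rcons -IH//.
have := H (size s); rewrite size_rcons nth_rcons ltnn eqxx => <-//.
by rewrite addrC subrK.
Qed.

Let steps := index_enum ('I_d * bool)%type.

(** The 2d step events are disjoint, each of mass 1/(2d), so they exhaust the probability. *)
Lemma step_almost_surely n :
  P (~` \bigcup_(p in [set` steps]) [set w | X n.+1 w - X n w = unit_step p]) = 0%E.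
Proof.
case: walkX => _ _ uX _.
have mstep (p : 'I_d * bool) : measurable [set w | X n.+1 w - X n w = unit_step p].
  exact: measurable_increment.
rewrite probability_setC; last exact: fin_bigcup_measurable.
rewrite measure_fin_bigcup//; last first.
  by move=> p q _ _ [w [/= -> /unit_step_inj]].
rewrite -fsbig_seq ?index_enum_uniq//.
rewrite (eq_bigr (fun=> ((2 * d)%N%:R^-1)%:E)); last by move=> p _; exact: uX.
have d0 : (0 < d)%N by rewrite (leq_ltn_trans _ (ltn_ord p0.1)).
rewrite sumEFin sumr_const card_prod card_ord card_bool (mulnC d).
rewrite -(mulr_natl ((2 * d)%N%:R^-1 : R)) divff ?subee//.
by rewrite pnatr_eq0 -lt0n muln_gt0.
Qed.

(** The Markov property in integrated form. The prefix [s] is arbitrary because the induction on [j]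
    splits its cylinder according to the next step; nonnegativity of [f] avoids integrability
    conditions. *)
Lemma integral_walk_prefix (f : 'rV[int]_d -> R) (j : nat) s :
  (forall x, 0 <= f x) ->
  (\int[P]_(w in walk_prefix s) (f (X (size s + j)%N w))%:E =
   (((2 * d)%N%:R^-1) ^+ size s * iter j (@walk_mean R d) f (endpoint s))%:E)%E.
Proof.
move=> f0; elim: j s => [|j IH] s.
  rewrite addn0 (eq_integral (cst (f (endpoint s))%:E)); last first.
    by move=> w; rewrite inE => /walk_prefix_endpoint ->.
  transitivity ((f (endpoint s))%:E * P (walk_prefix s))%E.
    by apply: integral_cst; exact: measurable_walk_prefix.
  by rewrite prob_walk_prefix -EFinM mulrC.
have [mX _ _ _] := walkX.
pose B := \bigcup_(p in [set` steps]) [set w | X (size s).+1 w - X (size s) w = unit_step p].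
have mB : measurable B.
  by apply: fin_bigcup_measurable => // p _; exact: measurable_increment.
have mf : measurable_fun setT (fun w => f (X (size s + j.+1)%N w)).
  by move=> _ A _; rewrite setTI; exact: (mX _ (f @^-1` A)).
rewrite (@ge0_negligible_integral _ _ _ _ _ (~` B)); first last.
- exact: step_almost_surely.
- by move=> w _; rewrite lee_fin.
- by apply/measurable_EFinP; exact: measurable_funTS.
- exact: measurable_walk_prefix.
- exact: measurableC.
have -> : walk_prefix s `\` ~` B =
    \big[setU/set0]_(p <- steps) walk_prefix (rcons s p).
  rewrite setDE setCK -bigcup_seq; apply/seteqP; split => w /=.
    move=> [ws [p /= _ wp]]; exists p => [|k] /=; first exact: mem_index_enum.
    rewrite size_rcons ltnS leq_eqVlt nth_rcons => /predU1P[->|ks].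
      by rewrite ltnn eqxx.
    by rewrite ks ws.
  move=> [p /= _ H]; split=> [k ks|].
    by rewrite H ?size_rcons ?nth_rcons ?ks// ltnS ltnW.
  exists p => /=; first exact: mem_index_enum.
  by rewrite H ?size_rcons// nth_rcons ltnn eqxx.
rewrite ge0_integral_bigsetU; first last.
- by move=> w _; rewrite lee_fin.
- by apply/measurable_EFinP; exact: measurable_funTS.
- move=> p q _ _ [w [/= /(_ (size s)) + /(_ (size s))]].
  by rewrite !size_rcons !nth_rcons ltnn eqxx => -> // /(_ (ltnSn _))/unit_step_inj.
- exact: index_enum_uniq.
- by move=> p; exact: measurable_walk_prefix.
rewrite (eq_bigr (fun p => ((2 * d)%N%:R^-1 ^+ (size s).+1 *
   iter j (@walk_mean R d) f (endpoint s + unit_step p))%:E)); last first.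
  move=> p _; rewrite addnS -addSn -(size_rcons s p) IH; do 3 f_equal.
  by rewrite /endpoint -cats1 big_cat /= big_seq1.
by rewrite sumEFin -mulr_sumr iterS /walk_mean exprSr mulrA.
Qed.

Lemma growthE (u : 'rV[int]_d -> R) n :
  growth P X u n = iter n (@walk_mean R d) (fun x => u x ^+ 2) 0.
Proof.
rewrite /growth unlock.
have := @integral_walk_prefix (fun x => u x ^+ 2) n [::] (fun x => sqr_ge0 _).
rewrite (_ : walk_prefix [::] = setT); last by apply/seteqP; split.
by rewrite add0n expr0 mul1r /endpoint big_nil => ->.
Qed.

End Walk.

(** * Second moments of multilinear monomials *)

Definition coord_prod (R : realType) {d : nat} (S : {set 'I_d})
    (x : 'rV[int]_d) : R :=
  \prod_(i in S) (x 0 i)%:~R.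

Lemma unit_stepE d (i : 'I_d) (b : bool) j :
  unit_step (i, b) 0 j = (-1) ^+ b * (i == j)%:R.
Proof. by rewrite !mxE eqxx /= eq_sym. Qed.

Lemma coord_prod_step (R : realType) d (S : {set 'I_d}) x i b :
  coord_prod R S (x + unit_step (i, b : bool)) =
  coord_prod R S x + (i \in S)%:R * (-1) ^+ b * coord_prod R (S :\ i) x.
Proof.
rewrite /coord_prod; case: (boolP (i \in S)) => iS; last first.
  rewrite !mul0r addr0; apply: eq_bigr => j jS; rewrite mxE unit_stepE.
  by rewrite (_ : i == j = false) ?mulr0 ?addr0//; apply: contraNF iS => /eqP ->.
rewrite (big_setD1 i iS) [in RHS](big_setD1 i iS) /= mxE unit_stepE eqxx mulr1.
rewrite (eq_bigr (fun j => (x 0 j)%:~R)) => [|j].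
  by rewrite rmorphD rmorphXn rmorphN1 mul1r mulrDl.
by rewrite !inE => /andP[ji _]; rewrite mxE unit_stepE eq_sym (negbTE ji) mulr0 addr0.
Qed.

(** The monomial is affine in each coordinate, so the two opposite steps along each axis cancel. *)
Lemma coord_prod_harmonic (R : realType) d (S : {set 'I_d}) :
  is_harmonic (@coord_prod R d S).
Proof.
move=> x; rewrite /laplacian.
rewrite (eq_bigr (fun p : 'I_d * bool => (p.1 \in S)%:R * (-1) ^+ p.2 * coord_prod R (S :\ p.1) x)).
  rewrite -(pair_bigA _ (fun (i : 'I_d) (b : bool) => (i \in S)%:R * (-1) ^+ b * coord_prod R (S :\ i) x)) /=.
  by rewrite big1 ?mulr0// => i _; rewrite big_bool /= expr0 expr1; ring.
by move=> [i b] _; rewrite coord_prod_step addrC addKr.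
Qed.

(** By (a+c)^2 + (a-c)^2 = 2a^2 + 2c^2 the cross terms of opposite steps cancel. *)
Lemma walk_mean_coord_prod_sqr (R : realType) d (S : {set 'I_d}) (x : 'rV_d) :
  (0 < d)%N ->
  walk_mean (fun y => coord_prod R S y ^+ 2) x =
  coord_prod R S x ^+ 2 + d%:R^-1 * \sum_(i in S) coord_prod R (S :\ i) x ^+ 2.
Proof.
move=> d0; have dR : d%:R != 0 :> R by rewrite pnatr_eq0 -lt0n.
rewrite /walk_mean.
rewrite (eq_bigr (fun p : 'I_d * bool => (coord_prod R S x + (p.1 \in S)%:R * (-1) ^+ p.2 *
   coord_prod R (S :\ p.1) x) ^+ 2)); last first.
  by move=> [i b] _; rewrite coord_prod_step.
rewrite -(pair_bigA _ (fun (i : 'I_d) (b : bool) => (coord_prod R S x + (i \in S)%:R * (-1) ^+ b *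
  coord_prod R (S :\ i) x) ^+ 2)) /=.
rewrite (eq_bigr (fun i => 2 * coord_prod R S x ^+ 2 +
   2 * (if i \in S then coord_prod R (S :\ i) x ^+ 2 else 0))); last first.
  by move=> i _; rewrite big_bool /= expr0 expr1; case: (i \in S) => /=; ring.
rewrite big_split /= sumr_const card_ord -mulr_sumr -big_mkcond /=.
by rewrite natrM -[_ *+ d]mulr_natl; field.
Qed.

Lemma iter_walk_mean_linear (R : realType) d m (f : 'rV[int]_d -> R) c (S : {set 'I_d}) g x :
  iter m (@walk_mean R d) (fun y => f y + c * \sum_(i in S) g i y) x =
  iter m (@walk_mean R d) f x + c * \sum_(i in S) iter m (@walk_mean R d) (g i) x.
Proof.
elim: m x => [//|m IH] x; rewrite !iterS /walk_mean.
under eq_bigr => p _ do rewrite IH.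
rewrite big_split /= -mulr_sumr exchange_big /= mulrDr; congr (_ + _).
by rewrite mulrCA mulr_sumr.
Qed.

Lemma iter_walk_mean_coord_prod (R : realType) d m (S : {set 'I_d}) : (0 < d)%N ->
  iter m (@walk_mean R d) (fun y => coord_prod R S y ^+ 2) 0 =
  (m ^_ #|S|)%:R / d%:R ^+ #|S|.
Proof.
move=> d0; have dR : d%:R != 0 :> R by rewrite pnatr_eq0 -lt0n.
elim: m S => [|m IH] S.
  rewrite /= ffact0n cards_eq0 /coord_prod; case: eqVneq => [->|/set0Pn[i iS]].
    by rewrite big_set0 cards0 expr0 expr1n divr1.
  by rewrite (big_setD1 i iS) /= mxE mul0r expr0n mul0r.
rewrite iterSr.
rewrite (_ : walk_mean _ = fun y => coord_prod R S y ^+ 2 + d%:R^-1 *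
  \sum_(i in S) coord_prod R (S :\ i) y ^+ 2); last first.
  by apply/funext => y; exact: walk_mean_coord_prod_sqr.
rewrite (@iter_walk_mean_linear _ _ _ _ _ _ (fun i y => coord_prod R (S :\ i) y ^+ 2)) IH.
rewrite (eq_bigr (fun=> (m ^_ #|S|.-1)%:R / d%:R ^+ #|S|.-1)); last first.
  by move=> i iS; rewrite IH (cardsD1 i S) iS.
rewrite sumr_const; case: #|S| => [|k]; first by rewrite mulr0n mulr0 addr0 !ffactn0.
rewrite /= ffactSS exprS -[_ *+ k.+1]mulr_natl.
(* The Pascal-type rule for falling factorials; when m < k every term vanishes, despite truncated
   subtraction. *)
have -> : (m.+1 * m ^_ k = m ^_ k.+1 + k.+1 * m ^_ k)%N.
  rewrite ffactnSr; case: (leqP k m) => km; last by rewrite ffact_small// !muln0.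
  by rewrite mulnC [(k.+1 * _)%N]mulnC -mulnDr addnS subnK.
by rewrite natrD natrM; field; rewrite expf_neq0 dR.
Qed.

(** * Choice of parameters and conclusion *)

Lemma ltr_powR {R : realType} (a : R) : 1 < a -> {homo powR a : x y / x < y}.
Proof.
move=> a1 x y xy.
by rewrite /powR gt_eqF ?(lt_trans _ a1)// ltr_expR ltr_pM2r ?ln_gt0.
Qed.

(** With n = N^2, n^(1/2+eps) >= N N^eps > N(8M+1) >= 2k+1 for k = 4MN. The exponent 2k+1 pays for
    4^k and one extra factor 2. *)
Lemma quadruple_weight {R : realType} (eps : R) (M N : nat) : 0 < eps ->
  (8 * M + 1)%N%:R `^ eps^-1 < N%:R ->
  2 `^ (- ((N ^ 2)%N%:R `^ (1 / 2 + eps))) * 2 ^+ (2 * (4 * M * N)).+1 < 1 :> R.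
Proof.
move=> e0 hN.
have N0 : 0 < N%:R :> R by apply: le_lt_trans hN; exact: powR_ge0.
have hNe : (8 * M + 1)%N%:R < (N%:R : R) `^ eps.
  have : ((8 * M + 1)%N%:R `^ eps^-1) `^ eps < (N%:R : R) `^ eps.
    by rewrite gt0_ltr_powR// nnegrE ?powR_ge0 ?ltW.
  by rewrite -powRrM mulVf ?gt_eqF// powRr1.
have h : (2 * (4 * M * N)).+1%:R < ((N ^ 2)%N%:R : R) `^ (1 / 2 + eps).
  rewrite powRD; last by rewrite natrX expf_neq0 ?implybT// gt_eqF.
  have -> : ((N ^ 2)%N%:R : R) `^ (1 / 2) = N%:R.
    by rewrite natrX div1r powR12_sqrt ?sqr_ge0// sqrtr_sqr normr_nat.
  have NNe : (N%:R : R) `^ eps <= (N ^ 2)%N%:R `^ eps.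
    apply: ge0_ler_powR; rewrite ?nnegrE ?ler0n// ?(ltW e0)//.
    by rewrite ler_nat expnS expn1 leq_pmulr// -(ltr0n R).
  apply: le_lt_trans (_ : N%:R * (8 * M + 1)%N%:R < _).
    by rewrite -natrM ler_nat; have := N0; rewrite ltr0n; lia.
  by rewrite ltr_pM2l// (lt_le_trans hNe).
rewrite -powR_mulrn// powRN mulrC ltr_pdivrMr ?powR_gt0// [ltRHS]mul1r.
by apply: ltr_powR; rewrite ?ltr1n.
Qed.

Theorem theorem1p13 (R : realType) (eps : R) (n0 : nat) (C : R)
    (heps : 0 < eps) (hC : 0 < C) :
  exists d0 : nat, forall d : nat, (d0 < d)%N ->
    exists u : 'rV[int]_d -> R,
      is_harmonic u /\
      exists n : nat, (n0 < n)%N /\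
        forall (disp : measure_display) (T : measurableType disp)
          (P : probability T R) (X : nat -> T -> 'rV[int]_d),
        simple_random_walk P X ->
        growth P X u (2 * n)%N >
          C * Num.sqrt (growth P X u n * growth P X u (4 * n)%N)
          + 2 `^ (- (n%:R `^ (1 / 2 + eps))) * growth P X u (4 * n)%N.
Proof.
pose M := (Num.truncn (2 * C)).+1.
have CM : 2 * C < M%:R by exact: truncnS_gt.
pose N := (maxn (maxn n0 (4 * M)) (Num.truncn ((8 * M + 1)%N%:R `^ eps^-1))).+1.
have NE : (8 * M + 1)%N%:R `^ eps^-1 < N%:R :> R.
  by apply: lt_le_trans (truncnS_gt _) _; rewrite ler_nat ltnS leq_maxr.
have [Nn0 NM] : (n0 < N)%N /\ (4 * M <= N)%N.
  split; rewrite /N; lia.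
pose k := (4 * M * N)%N.
have kN : (k <= N ^ 2)%N by rewrite /k expnS expn1 leq_mul2r NM orbT.
(* The dimension only has to supply k distinct coordinates for the monomial. *)
exists k => d kd; have d0 : (0 < d)%N by apply: leq_ltn_trans kd.
pose S := [set i : 'I_d | (i < k)%N].
have cS : #|S| = k.
  by rewrite cardsE -sum1_card -(big_ord_widen d (fun=> 1%N) (ltnW kd)) sum1_card card_ord.
exists (coord_prod R S); split; first exact: coord_prod_harmonic.
exists (N ^ 2)%N; split; first by rewrite (leq_trans Nn0)// expnS expn1 leq_pmulr.
move=> disp T P X walkX.
have gE m : growth P X (coord_prod R S) m = (m ^_ k)%:R / d%:R ^+ k.
  rewrite (growthE walkX (Ordinal d0, false)).
  by rewrite iter_walk_mean_coord_prod// cS.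
rewrite !gE.
have dk0 : 0 < (d%:R ^+ k : R)^-1 by rewrite invr_gt0 exprn_gt0// ltr0n.
have F0 : 0 < ((2 * N ^ 2) ^_ k)%:R :> R.
  by rewrite ltr0n ffact_gt0 (leq_trans kN)// leq_pmull.
have gap : (M%:R ^+ 2 * (((N ^ 2) ^_ k)%:R * ((4 * N ^ 2) ^_ k)%:R) <=
    ((2 * N ^ 2) ^_ k)%:R ^+ 2 :> R).
  by rewrite -!natrX -!natrM ler_nat; apply: ffact_sqrt_gap.
have quad : (((4 * N ^ 2) ^_ k)%:R <= 2 ^+ (2 * k) * ((2 * N ^ 2) ^_ k)%:R :> R).
  by rewrite -natrX -natrM ler_nat expnM; apply: ffact_quadruple.
have wk := @quadruple_weight R eps M N heps NE.
have w0 := powR_ge0 (2 : R) (- ((N ^ 2)%N%:R `^ (1 / 2 + eps))).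
rewrite -/k exprS in wk.
move: gap quad F0 w0 wk; set w := 2 `^ _; set E := 2 ^+ _; set q := (_ ^+ k)^-1 in dk0 *.
set a := ((N ^ 2) ^_ k)%:R; set b := ((4 * N ^ 2) ^_ k)%:R; set f := ((2 * N ^ 2) ^_ k)%:R.
move=> gap quad F0 w0 wk.
have sqrt_le : M%:R * Num.sqrt (a * q * (b * q)) <= f * q.
  have fq0 : 0 <= f * q by rewrite mulr_ge0 // ltW.
  rewrite -(ler_pXn2r (ltn0Sn 1)) ?nnegrE ?fq0 ?mulr_ge0 ?sqrtr_ge0 ?ler0n ?(ltW dk0)//.
  rewrite exprMn sqr_sqrtr; last by rewrite !mulr_ge0 ?(ltW dk0)// ler0n.
  have -> : M%:R ^+ 2 * (a * q * (b * q)) = M%:R ^+ 2 * (a * b) * q ^+ 2 by ring.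
  by rewrite exprMn ler_pM2r// exprn_gt0.
(* Here 2C < M leaves the other half of Q(2n) for the tail, whose strict bound makes the final
   inequality strict. *)
have root_part : 2 * (C * Num.sqrt (a * q * (b * q))) <= f * q.
  by apply: le_trans sqrt_le; rewrite mulrA ler_wpM2r ?sqrtr_ge0// ltW.
have tail_part : 2 * (w * (b * q)) < f * q.
  rewrite !mulrA ltr_pM2r//; apply: le_lt_trans (_ : (w * (2 * E)) * f < _).
    have -> : w * (2 * E) * f = 2 * w * (E * f) by ring.
    by rewrite ler_wpM2l// mulr_ge0.
  by rewrite -[ltRHS]mul1r ltr_pM2r.
lra.
Qed.
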